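(* Let $n$ and $k$ be integers with $3\leq k\leq n$. For every connected graph $G$ of order $n$, $$1\leq \lambda_k(G)\leq n-\lceil k/2\rceil.$$ Moreover, the upper and lower bounds are tight: there is a connected graph of order $n$ attaining the upper bound, and there is a connected graph of order $n$ attaining the lower bound.
   Context: All graphs are undirected, finite and simple. For a graph $G$ and a set $S\subseteq V(G)$ of at least two vertices, a tree connecting $S$ is a subgraph $T$ of $G$ that is a tree with $S\subseteq V(T)$. Let $\lambda(S)$ be the maximum number of pairwise edge-disjoint trees connecting $S$ in $G$. The generalized $k$-edge-connectivity of $G$ is $\lambda_k(G)=\min\{\lambda(S) : S\subseteq V(G),\ |S|=k\}$. *)

(* Defs.v *)
From mathcomp Require Import all_boot all_order.

Set Implicit Arguments.
Unset Strict Implicit.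
Unset Printing Implicit Defensive.

Record sgraph := SGraph {
  vertex :> finType;
  edges : {set {set vertex}};
  card_edge : forall e, e \in edges -> #|e| = 2
}.

Definition graph_order (G : sgraph) : nat := #|G|.

(* A pair (W, F) of a vertex set and an edge set; it denotes a graph only when
   every member of F is a 2-element subset of W, which [subgraph] below ensures. *)
Definition pregraph (V : finType) := ({set V} * {set {set V}})%type.

Section Pregraph.
Variable V : finType.
Implicit Types (H T : pregraph V) (F : {set {set V}}).

Definition adj F : rel V := fun x y => [set x; y] \in F.

Definition pg_connected H : bool :=
  (H.1 != set0) && [forall x in H.1, forall y in H.1, connect (adj H.2) x y].

(* A cycle is a cyclic sequence of at least 3 distinct vertices; having no
   repetition it has length at most #|V|, which makes the quantifier finite. *)
Definition acyclic H : bool :=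
  ~~ [exists m : 'I_#|V|.+1, exists c : m.-tuple V,
       [&& 2 < size c, uniq c & cycle (adj H.2) c]].

Lemma acyclicP H :
  reflect (forall c : seq V, 2 < size c -> uniq c -> ~~ cycle (adj H.2) c)
          (acyclic H).
Proof.
apply: (iffP idP) => [/existsPn noc c c3 Uc|noc].
  have ltc : size c < #|V|.+1.
    by rewrite ltnS -(card_uniqP Uc) max_card.
  have /existsPn/(_ (in_tuple c)) := noc (Ordinal ltc).
  by rewrite /= c3 Uc.
apply/existsPn => m; apply/existsPn => c; apply/negP => /and3P[c3 Uc].
by apply/negP; apply: noc.
Qed.

Definition is_tree H : bool := pg_connected H && acyclic H.

Definition edge_disjoint (P : {set pregraph V}) : bool :=
  [forall T1 in P, forall T2 in P, (T1 != T2) ==> [disjoint T1.2 & T2.2]].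

End Pregraph.

Definition connected (G : sgraph) : bool := pg_connected ([set: G], edges G).

Definition subgraph (G : sgraph) (H : pregraph G) : bool :=
  (H.2 \subset edges G) && [forall e in H.2, e \subset H.1].

Definition tree_connecting (G : sgraph) (S : {set G}) (T : pregraph G) : bool :=
  [&& subgraph T, is_tree T & S \subset T.1].

(* Families of trees are represented as sets. For 1 < #|S| every tree connecting
   S has an edge, so edge-disjoint trees are distinct and nothing is lost. *)
Definition lambda (G : sgraph) (S : {set G}) : nat :=
  \max_(P : {set pregraph G} |
        [forall T in P, tree_connecting S T] && edge_disjoint P) #|P|.

(* The default value of the iterated minimum is the corresponding maximum, so it
   has no influence when some S has k elements; see [lambda_kP]. *)
Definition lambda_k (k : nat) (G : sgraph) : nat :=
  let M := \max_(S : {set G} | #|S| == k) lambda S in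
  \big[Order.min/M]_(S : {set G} | #|S| == k) lambda S.

Lemma lambda_kP (k : nat) (G : sgraph) : k <= graph_order G ->
  (exists2 S : {set G}, #|S| = k & lambda_k k G = lambda S) /\
  (forall S : {set G}, #|S| = k -> lambda_k k G <= lambda S).
Proof.
move=> lekn.
have [S0 S0k] : exists S : {set G}, #|S| == k.
  exists [set x in take k (enum G)]; rewrite cardsE.
  have /card_uniqP-> : uniq (take k (enum G)) by rewrite take_uniq ?enum_uniq.
  by rewrite size_takel // -cardE.
split; last first.
  by move=> S /eqP Sk; rewrite -leEnat; apply: Order.TotalTheory.bigmin_le_cond.
have [S1 S1k maxE] : {S1 : {set G} | #|S1| == k &
    \max_(S : {set G} | #|S| == k) lambda S = lambda S1}.
  apply: (@eq_bigmax_cond _ [pred S : {set G} | #|S| == k]).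
  by apply/card_gt0P; exists S0.
suff [S /eqP] : exists2 S : {set G}, #|S| == k & lambda_k k G = lambda S.
  by exists S.
rewrite /lambda_k.
apply: (big_ind (fun m => exists2 S : {set G}, #|S| == k & m = lambda S)).
- by exists S1.
- move=> a b [A Ak ->] [B Bk ->].
  by rewrite /Order.min; case: ifP => _; [exists A | exists B].
- by move=> S Sk; exists S.
Qed.

(* Main.v *)
(* Upper bound: let [#|S| = k] and count edges meeting [S].  Sending each vertex
   to the next one on a shortest path to a fixed root is injective on edges, so a
   tree connecting [S] has at least [k] edges meeting [S] if it has a vertex
   outside [S], and [k - 1] otherwise.  There are at most ['C(k, 2) + k (n - k)]
   edges meeting [S], and at most [k / 2] trees live inside [S], since they share
   the ['C(k, 2)] edges there; hence at most [n - k / 2] trees in all.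
   Equality holds for the complete graph: take the [n - k] stars from a vertex
   outside [S] onto [S], and [k / 2] double stars inside [S].  With [S] numbered
   from 0 to [k - 1], the [i]-th double star has centre [{2i, 2i + 1}].  The lower
   bound is a spanning tree, and it is attained by the star, where a leaf has
   degree 1. *)
Require Import Defs.
From mathcomp Require Import all_boot all_order.
From mathcomp Require Import zify.

Set Implicit Arguments.
Unset Strict Implicit.
Unset Printing Implicit Defensive.

(** * Trees described by parent functions *)

Lemma eq_set2 (V : finType) (x y u v : V) :
  [set x; y] = [set u; v] -> (x = u /\ y = v) \/ (x = v /\ y = u).
Proof.
move=> E.
have xE : x \in [set u; v] by rewrite -E set21.
have yE : y \in [set u; v] by rewrite -E set22.
have uE : u \in [set x; y] by rewrite E set21.
have vE : v \in [set x; y] by rewrite E set22.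
by case/set2P: xE; case/set2P: yE; case/set2P: uE; case/set2P: vE; intuition congruence.
Qed.

Lemma adj_sym (V : finType) (F : {set {set V}}) : symmetric (adj F).
Proof. by move=> x y; rewrite /adj setUC. Qed.

(** Here [d] is the distance to [r], and [p x] is the second vertex of a shortest path from [x] to
    [r]. *)
Lemma descending_parent (V : finType) (e : rel V) (r : V) :
  exists p : V -> V, exists d : V -> nat,
    forall x, connect e x r -> x != r -> e x (p x) && (d (p x) < d x).
Proof.
have /fin_all_exists[d dP] : forall x, exists n, connect e x r ->
    (exists2 s, path e x s /\ last x s = r & size s = n) /\
    (forall s, path e x s -> last x s = r -> n <= size s).
  move=> x; case: (boolP (connect e x r)) => [/connectP[s0 s0P s0r]|_]; last by exists 0.
  pose P n := [exists s : n.-tuple V, path e x s && (last x s == r)].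
  have PsP s : path e x s -> last x s = r -> P (size s).
    by move=> sP sr; apply/existsP; exists (in_tuple s); rewrite /= sP sr eqxx.
  have exP : exists n, P n by exists (size s0); apply: PsP.
  case: (ex_minnP exP) => n /existsP[s /andP[sP /eqP sr]] minn.
  exists n => _; split; first by exists s; rewrite ?size_tuple.
  by move=> s' s'P s'r; apply/minn/PsP.
have /fin_all_exists[p pP] : forall x, exists y,
    connect e x r -> x != r -> e x y && (d y < d x).
  move=> x; case: (boolP (connect e x r)) => [cxr|_]; last by exists x.
  have [[s [sP sr] sd] _] := dP x cxr.
  case: s sP sr sd => [_ /= -> _|y s /= /andP[exy sP] sr sd]; first by exists r; rewrite eqxx.
  exists y => _ _; rewrite exy -sd ltnS.
  have cyr : connect e y r by apply/connectP; exists s.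
  by have [_ ->] := dP y cyr.
by exists p, d.
Qed.

Definition parent_tree (V : finType) (W : {set V}) (r : V) (p : V -> V) : pregraph V :=
  (W, [set [set x; p x] | x in W :\ r]).

(** Following [p] lowers [d] until [r] is reached, whence connectedness. Any strictly decreasing
    rank may serve as [d], not only a distance. *)
Lemma parent_tree_is_tree (V : finType) (W : {set V}) (r : V) (p : V -> V) (d : V -> nat) :
  r \in W -> (forall x, x \in W -> x != r -> p x \in W /\ d (p x) < d x) ->
  is_tree (parent_tree W r p).
Proof.
move=> rW pP; set F := (parent_tree W r p).2.
have Fp x : x \in W -> x != r -> adj F x (p x).
  by move=> xW xr; apply/imsetP; exists x; rewrite // !inE xr.
have conn_r x : x \in W -> connect (adj F) x r.
  elim: {x}(d x).+1 {-2}x (ltnSn (d x)) => // n IHn x; rewrite ltnS => dx xW.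
  have [->|xr] := eqVneq x r; first exact: connect0.
  have [pW dp] := pP x xW xr.
  by apply: connect_trans (connect1 (Fp x xW xr)) _; apply: IHn => //; apply: leq_trans dx.
apply/andP; split.
  apply/andP; split; first by apply/set0Pn; exists r.
  apply/forall_inP => x xW; apply/forall_inP => y yW.
  apply: connect_trans (conn_r x xW) _.
  by rewrite (sym_connect_sym (@adj_sym _ F)) conn_r.
(* both neighbours on the cycle of a vertex maximizing [d] are its parent *)
apply/acyclicP => c c3 Uc; apply/negP => cycc.
have [x0 x0c] : exists x, x \in c.
  by case: c c3 {Uc cycc} => // x s _; exists x; rewrite mem_head.
case: (@arg_maxnP _ x0 (mem c) d x0c) => x xc xmax.
have nbP u : u \in c -> adj F x u -> u = p x.
  move=> uc /imsetP[t]; rewrite !inE => /andP[tr tW] /eq_set2[[-> ->]//|[xp ut]].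
  have [_] := pP t tW tr; rewrite -xp -ut => ltd.
  by have := leq_ltn_trans (xmax _ uc) ltd; rewrite ltnn.
(* Rotate the cycle to start at [x]. Its second and last vertices [y] and [z] are distinct, the
   length being at least 3, yet both equal [p x]. *)
have [i s Ec] := rot_to xc.
have memc u : (u \in c) = (u \in x :: s) by rewrite -Ec mem_rot.
move: c3 Uc cycc; rewrite -(size_rot i) -(rot_uniq i) -(rot_cycle i) Ec.
case: s Ec memc => [//|y s] Ec memc; case/lastP: s Ec memc => [//|s z] Ec memc _ Uc.
rewrite /= rcons_path last_rcons => /and3P[xy _ zx].
have yp : y = p x by apply: nbP; rewrite // memc !inE eqxx orbT.
have zp : z = p x.
  by apply: nbP; rewrite ?memc ?(adj_sym F x) // !inE mem_rcons mem_head !orbT.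
by move: Uc; rewrite yp zp /= mem_rcons mem_head /= andbF.
Qed.

Lemma parent_tree_connecting (G : sgraph) (S W : {set G}) (r : G) (p : G -> G) (d : G -> nat) :
  r \in W -> S \subset W ->
  (forall x, x \in W -> x != r ->
     [/\ p x \in W, d (p x) < d x & [set x; p x] \in edges G]) ->
  tree_connecting S (parent_tree W r p).
Proof.
move=> rW SW pP; apply/and3P; split=> //.
  apply/andP; split.
    by apply/subsetP => _ /imsetP[x /setD1P[xr xW] ->]; have [] := pP x xW xr.
  apply/forall_inP => _ /imsetP[x /setD1P[xr xW] ->]; have [pW _ _] := pP x xW xr.
  by apply/subsetP => y /set2P[]->.
apply: (@parent_tree_is_tree _ _ _ _ d) => // x xW xr.
by have [] := pP x xW xr.
Qed.

(** * Edges used by connecting trees, and edge-disjoint families *)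

Lemma connected_card_incident (V : finType) (H : pregraph V) (A : {set V}) (r : V) :
  pg_connected H -> r \in H.1 -> A \subset H.1 :\ r ->
  #|A| <= #|[set e in H.2 | ~~ [disjoint e & A]]|.
Proof.
case/andP=> _ /forall_inP cH rH /subsetP sA.
have [p [d pd]] := descending_parent (adj H.2) r.
have pP x : x \in A -> adj H.2 x (p x) && (d (p x) < d x).
  move/sA/setD1P=> [xr xH]; apply: pd => //.
  by have /forall_inP := cH x xH; apply.
rewrite -(card_in_imset (f := fun x => [set x; p x])).
  apply/subset_leq_card/subsetP => _ /imsetP[x xA ->].
  have /andP[xp _] := pP x xA; rewrite inE; apply/andP; split=> //.
  by apply/pred0Pn; exists x; rewrite /= xA set21.
(* If distinct vertices gave the same edge, each would be the parent of the other, and [d] would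
   decrease both ways. *)
move=> x y xA yA /eq_set2[[]//|[xp px]].
have /andP[_] := pP x xA; have /andP[_] := pP y yA.
by rewrite px -xp => /ltn_trans lt /lt; rewrite ltnn.
Qed.

(** Rooting at a second vertex of [S] makes [v] a non-root, which has a parent edge. *)
Lemma tree_connecting_incident (G : sgraph) (S : {set G}) (v : G) (T : pregraph G) :
  1 < #|S| -> v \in S -> tree_connecting S T -> exists2 e, e \in T.2 & v \in e.
Proof.
move=> S1 vS /and3P[_ /andP[cT _] /subsetP ST].
have /card_gt0P[r /setD1P[rv rS]] : 0 < #|S :\ v| by move: S1; rewrite (cardsD1 v) vS.
have sv : [set v] \subset T.1 :\ r by rewrite sub1set !inE eq_sym rv ST.
have := connected_card_incident cT (ST r rS) sv; rewrite cards1 => /card_gt0P[e].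
by rewrite inE disjoint_sym disjoints1 negbK => /andP[]; exists e.
Qed.

(** Allows families indexed by a type: every tree has an edge, so disjointness makes [T] injective
    and its image has [#|I|] members. *)
Lemma lambda_geP (I : finType) (G : sgraph) (S : {set G}) (T : I -> pregraph G) :
  1 < #|S| -> (forall i, tree_connecting S (T i)) ->
  (forall i j e, e \in (T i).2 -> e \in (T j).2 -> i = j) -> #|I| <= lambda S.
Proof.
move=> S1 treeT disjT.
have injT : injective T.
  move=> i j Tij; have /card_gt0P[v vS] : 0 < #|S| by apply: ltnW.
  have [e ei _] := tree_connecting_incident S1 vS (treeT i).
  by apply: (disjT _ _ e); rewrite -?Tij.
rewrite -cardsT -(card_imset _ injT); apply: (@bigmax_sup _ (T @: setT)) => //.
apply/andP; split; first by apply/forall_inP => _ /imsetP[i _ ->].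
apply/forall_inP => _ /imsetP[i _ ->]; apply/forall_inP => _ /imsetP[j _ ->].
apply/implyP => nij; rewrite -setI_eq0; apply: contraR nij => /set0Pn[e /setIP[ei ej]].
by rewrite (disjT i j e).
Qed.

Lemma lambda_leP (G : sgraph) (S : {set G}) (m : nat) :
  (forall P : {set pregraph G}, (forall T, T \in P -> tree_connecting S T) ->
     edge_disjoint P -> #|P| <= m) -> lambda S <= m.
Proof. by move=> h; apply/bigmax_leqP => P /andP[/forall_inP tP dP]; apply: h. Qed.

Lemma edge_disjoint_eq (V : finType) (P : {set pregraph V}) T1 T2 e :
  edge_disjoint P -> T1 \in P -> T2 \in P -> e \in T1.2 -> e \in T2.2 -> T1 = T2.
Proof.
move=> /forall_inP dP T1P T2P e1 e2; apply/eqP; apply: contraTT isT => ne.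
have /forall_inP/(_ _ T2P) := dP _ T1P; rewrite ne /= -setI_eq0 => /eqP/setP/(_ e).
by rewrite !inE e1 e2.
Qed.

(** Double counting: each edge of [X] lies in at most one tree of [Q]. *)
Lemma edge_disjoint_sum (V : finType) (P Q : {set pregraph V}) (X : {set {set V}}) :
  edge_disjoint P -> Q \subset P -> \sum_(T in Q) #|T.2 :&: X| <= #|X|.
Proof.
move=> dP /subsetP QP.
have -> : \sum_(T in Q) #|T.2 :&: X| =
          \sum_(e in X) \sum_(T in Q) if e \in T.2 then 1 else 0.
  rewrite exchange_big; apply: eq_bigr => T _.
  by rewrite -big_mkcondr sum1_card; apply: eq_card => e; rewrite !inE andbC.
rewrite -sum1_card; apply: leq_sum => e _.
rewrite -big_mkcondr sum1_card; apply/card_le1_eqP => T1 T2 /andP[T1Q e1] /andP[T2Q e2].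
by apply: (edge_disjoint_eq dP _ _ e2 e1); apply: QP.
Qed.

Lemma lambda_le_incident (G : sgraph) (S : {set G}) (v : G) :
  1 < #|S| -> v \in S -> lambda S <= #|[set e in edges G | v \in e]|.
Proof.
move=> S1 vS; apply: lambda_leP => P tP dP.
rewrite -sum1_card; apply: leq_trans _ (edge_disjoint_sum _ dP (subxx P)).
apply: leq_sum => T TP; have [e eT ve] := tree_connecting_incident S1 vS (tP T TP).
apply/card_gt0P; exists e; rewrite !inE eT ve andbT.
by have /and3P[/andP[/subsetP sT _] _ _] := tP T TP; apply: sT.
Qed.

(** * The upper bound, by counting pairs of vertices *)

Lemma double_bin2 (m : nat) : 'C(m, 2).*2 = m * m.-1.
Proof. by rewrite bin2 halfK; case: m => // m; rewrite oddM /= andNb subn0. Qed.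

Lemma bin2D (m n : nat) : 'C(m + n, 2) = 'C(m, 2) + ('C(n, 2) + m * n).
Proof. by elim: n => [|n IHn]; rewrite ?muln0 ?addn0 // addnS !binS !bin1 IHn; lia. Qed.

(** Remove the pairs inside [~: S] from all pairs; [bin2D] splits the total accordingly. *)
Lemma card_pairs_meeting (V : finType) (S : {set V}) :
  #|[set e : {set V} | ~~ [disjoint e & S] & #|e| == 2]| = 'C(#|S|, 2) + #|S| * #|~: S|.
Proof.
have := bin2D #|~: S| #|S|; rewrite [_ + #|S|]addnC cardsC -card_draws.
rewrite -[LHS](cardsID [set e : {set V} | [disjoint e & S]]) -cards_draws [#|~: S| * _]mulnC.
have -> : [set B : {set V} | B \subset ~: S & #|B| == 2] =
          [set A : {set V} | #|A| == 2] :&: [set e : {set V} | [disjoint e & S]].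
  by apply/setP => e; rewrite !inE disjoints_subset andbC.
move/addnI <-; by apply: eq_card => e; rewrite !inE andbC.
Qed.

Lemma lambda_le (G : sgraph) (S : {set G}) (k : nat) :
  1 < k -> #|S| = k -> lambda S <= graph_order G - uphalf k.
Proof.
move=> k1 Sk; apply: lambda_leP => P tP dP.
(* [X] and [Y] contain all pairs, adjacent or not, so their sizes depend only on [#|S|] and
   [#|G|]. *)
pose X := [set e : {set G} | ~~ [disjoint e & S] & #|e| == 2].
pose Y := [set e : {set G} | e \subset S & #|e| == 2].
pose P1 := [set T in P | T.1 == S]; pose P2 := [set T in P | T.1 != S].
have cP : #|P| = #|P1| + #|P2|.
  by rewrite -(cardsID [set T | T.1 == S] P); congr (_ + _); apply: eq_card => T; rewrite !inE // andbC.
have sP1 : P1 \subset P by apply/subsetP => T; rewrite inE => /andP[].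
have sP2 : P2 \subset P by apply/subsetP => T; rewrite inE => /andP[].
have edge2 T e : T \in P -> e \in T.2 -> #|e| == 2.
  by case/tP/and3P=> /andP[/subsetP sT _] _ _ /sT /card_edge ->.
have meet T r (A : {set G}) : T \in P -> r \in T.1 -> A \subset S :\ r -> #|A| <= #|T.2 :&: X|.
  move=> TP rT AS; have /and3P[_ /andP[cT _] ST] := tP T TP.
  have AT := subset_trans AS (setSD [set r] ST).
  apply: leq_trans (connected_card_incident cT rT AT) _.
  apply/subset_leq_card/subsetP => e; rewrite !inE => /andP[eT meetA].
  rewrite eT (edge2 T) // andbT /=; apply: contra meetA => dS.
  by apply: disjointWr dS; apply: subset_trans AS (subsetDl _ _).
(* A tree on [S] itself must be rooted in [S], which costs one edge; for [P2] the root is chosen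
   outside [S]. *)
have P1X T : T \in P1 -> k.-1 <= #|T.2 :&: X|.
  rewrite inE => /andP[TP /eqP TS].
  have /card_gt0P[r rS] : 0 < #|S| by lia.
  have -> : k.-1 = #|S :\ r| by have := cardsD1 r S; rewrite rS; lia.
  by apply: (meet T r) => //; rewrite TS.
have P2X T : T \in P2 -> k <= #|T.2 :&: X|.
  rewrite inE => /andP[TP TS]; have /and3P[_ _ ST] := tP T TP.
  have /properP[_ [r rT rS]] : S \proper T.1 by rewrite properEneq eq_sym TS.
  by rewrite -Sk; apply: (meet T r) => //; apply/subsetD1P.
have P1Y T : T \in P1 -> k.-1 <= #|T.2 :&: Y|.
  move=> TP1; apply: leq_trans (P1X T TP1) _; move: TP1; rewrite inE => /andP[TP /eqP TS].
  apply/subset_leq_card/subsetP => e; rewrite !inE => /and3P[eT _ ->]; rewrite eT /= andbT -TS.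
  by have /and3P[/andP[_ /forall_inP sT] _ _] := tP T TP; apply: sT.
have cY : #|P1| * k.-1 <= 'C(k, 2).
  rewrite -Sk -cards_draws Sk -sum_nat_const; apply: leq_trans _ (edge_disjoint_sum Y dP sP1).
  exact: leq_sum.
have cX : #|P1| * k.-1 + #|P2| * k <= #|X|.
  apply: leq_trans _ (edge_disjoint_sum X dP (subxx P)).
  have -> : \sum_(T in P) #|T.2 :&: X| =
            \sum_(T in P1) #|T.2 :&: X| + \sum_(T in P2) #|T.2 :&: X|.
    by rewrite (bigID (fun T => T.1 == S)); congr (_ + _); apply: eq_bigl => T; rewrite inE.
  by rewrite -!sum_nat_const leq_add // leq_sum.
have cS := cardsC S; rewrite Sk in cS.
rewrite /X card_pairs_meeting Sk in cX.
rewrite /graph_order cP -cS; move: (#|P1|) (#|P2|) (#|~: S|) cY cX => x y m cY cX.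
have c2 := double_bin2 k.
have x2 : x.*2 <= k.
  by rewrite -(@leq_pmul2r k.-1) -?doubleMl -?c2 ?leq_double //; lia.
(* Adding [x] to [cX] and doubling gives [2k(x + y) <= k(k - 1) + 2km + 2x]. By [x2] the right side
   is at most [k(k + 2m)]; cancel [k]. *)
suff : (x + y).*2 <= k + m.*2 by lia.
rewrite -(@leq_pmul2l k); last by lia.
have xk : x * k.-1 + x = x * k by rewrite -mulnSr prednK //; lia.
have kk : k * k.-1 + k = k * k by rewrite -mulnSr prednK //; lia.
by rewrite -doubleMr !mulnDr -doubleMr; lia.
Qed.

(** * The lower bound, by a shortest-path spanning tree *)

Lemma lambda_ge1 (G : sgraph) (S : {set G}) : connected G -> 1 < #|S| -> 0 < lambda S.
Proof.
move=> /andP[_ /forall_inP cG] S1.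
have /card_gt0P[r _] : 0 < #|S| by apply: ltnW.
have [p [d pd]] := descending_parent (adj (edges G)) r.
suff tT : tree_connecting S (parent_tree setT r p).
  by rewrite -card_unit; apply: (@lambda_geP _ _ _ (fun=> parent_tree setT r p)) => // -[] [].
apply: (@parent_tree_connecting _ _ _ _ _ d) => // x _ xr.
have cxr : connect (adj (edges G)) x r by have /forall_inP -> := cG x (in_setT x).
by have /andP[xp dp] := pd x cxr xr.
Qed.

(** * The complete graph attains the upper bound *)

Lemma complete_card_edge (V : finType) (e : {set V}) :
  e \in [set e : {set V} | #|e| == 2] -> #|e| = 2.
Proof. by rewrite inE => /eqP. Qed.

Definition complete_graph (V : finType) := SGraph (@complete_card_edge V).

Lemma complete_edge (V : finType) (x y : V) :
  ([set x; y] \in edges (complete_graph V)) = (x != y).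
Proof. by rewrite in_set cards2; case: (x != y). Qed.

Lemma complete_connected (V : finType) : 0 < #|V| -> connected (complete_graph V).
Proof.
move=> /card_gt0P[v _]; apply/andP; split; first by apply/set0Pn; exists v; rewrite inE.
apply/forall_inP => x _; apply/forall_inP => y _.
have [->|xy] := eqVneq x y; first exact: connect0.
by apply/connect1; rewrite /adj complete_edge.
Qed.

(** The parity twist divides the four edges between two pairs of centres evenly between their double
    stars. The case [x./2 = i] falls in the second branch, so [2i + 1] hangs from the root [2i]. *)
Definition dstar_parent (i x : nat) : nat :=
  i.*2 + (if i < x./2 then odd x else ~~ odd x).

(* Of the four edges between the centres of two double stars, the two preserving
   parity belong to the star of lower index, the other two to the higher one. *)
Definition dstar_owner (x y : nat) : nat :=
  if odd x == odd y then minn x./2 y./2 else maxn x./2 y./2.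

Lemma dstar_ownerC (x y : nat) : dstar_owner x y = dstar_owner y x.
Proof. by rewrite /dstar_owner eq_sym minnC maxnC. Qed.

(** The index can be read off any edge, so double stars are edge-disjoint. The parent has half [i],
    and shares the parity of [x] exactly when [i < x./2], so the minimum or maximum taken is [i]. *)
Lemma dstar_owner_parent (i x : nat) : dstar_owner x (dstar_parent i x) = i.
Proof.
rewrite /dstar_owner /dstar_parent [i.*2 + _]addnC; case: ltnP => ix.
  rewrite half_bit_double oddD odd_double addbF; case: (odd x); exact/minn_idPr/ltnW.
rewrite half_bit_double oddD odd_double addbF; case: (odd x); exact/maxn_idPr.
Qed.

(** The decreasing rank for the double star rooted at [2i]. It is not the distance: leaves adjacent
    to the root also have rank 2. *)
Definition dstar_rank (i x : nat) : nat :=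
  if x == i.*2 then 0 else if x == i.*2.+1 then 1 else 2.

Lemma dstar_rank_parent (i x : nat) :
  x != i.*2 -> dstar_rank i (dstar_parent i x) < dstar_rank i x.
Proof.
move=> /negPf xi; rewrite /dstar_rank xi.
have [->|_] := eqVneq x i.*2.+1; last first.
  have [->|->] : dstar_parent i x = i.*2 \/ dstar_parent i x = i.*2.+1.
  - by rewrite /dstar_parent; case: ifP => _; case: odd => /=; rewrite ?addn1 ?addn0; auto.
  - by rewrite eqxx.
  - by rewrite eqxx; case: eqP.
rewrite /dstar_parent.
by rewrite -[i.*2.+1]/(true + i.*2) half_bit_double ltnn oddD odd_double addn0 eqxx.
Qed.

Lemma complete_lambda_ge (V : finType) (S : {set complete_graph V}) (k : nat) :
  1 < k -> #|S| = k -> #|V| - uphalf k <= lambda S.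
Proof.
move=> k1 Sk.
have [v0 v0S] : exists v, v \in S by apply/card_gt0P; lia.
pose num x := index x (enum S); pose vtx := nth v0 (enum S).
have szS : size (enum S) = k by rewrite -cardE.
have vtxS i : i < k -> vtx i \in S by rewrite -szS => ik; rewrite -mem_enum mem_nth.
have vtxK i : i < k -> num (vtx i) = i by rewrite -szS => ik; rewrite /num index_uniq ?enum_uniq.
have numlt x : x \in S -> num x < k by rewrite -mem_enum -szS index_mem.
have numK x : x \in S -> vtx (num x) = x by rewrite -mem_enum => xS; rewrite /vtx nth_index.
pose p i x := vtx (dstar_parent i (num x)).
have plt i x : i < k./2 -> dstar_parent i x < k.
  by rewrite /dstar_parent; case: (if _ then _ else _); lia.
pose T (z : 'I_k./2 + {w | w \notin S}) : pregraph (complete_graph V) :=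
  match z with
  | inl i => parent_tree S (vtx i.*2) (p i)
  | inr w => parent_tree (val w |: S) (val w) (fun=> val w)
  end.
(* The count is [k./2 + (#|V| - k)], and [k - k./2] is [uphalf k]. *)
have -> : #|V| - uphalf k = #|{: 'I_k./2 + {w | w \notin S}}|.
  rewrite card_sum card_ord card_sig.
  have -> : #|[pred w | w \notin S]| = #|~: S| by apply: eq_card => w; rewrite !inE.
  have -> : #|V| = k + #|~: S| by rewrite -Sk cardsC.
  lia.
apply: (@lambda_geP _ _ _ T); first by rewrite Sk.
  case=> [[i ik]|[w wS]] /=; last first.
    apply: (@parent_tree_connecting _ _ _ _ _ (fun x => nat_of_bool (x != w))).
    - by rewrite setU11.
    - exact: subsetUr.
    - by move=> x xW xw; rewrite setU11 complete_edge eqxx xw.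
  apply: (@parent_tree_connecting _ _ _ _ _ (dstar_rank i \o num)) => //.
    by apply: vtxS; lia.
  move=> x xS xi.
  have dp : dstar_rank i (num (p i x)) < dstar_rank i (num x).
    rewrite vtxK ?plt // dstar_rank_parent //.
    by apply: contra xi => /eqP <-; rewrite numK.
  split=> //; first exact/vtxS/plt.
  by rewrite complete_edge; apply: contraTneq dp => <-; rewrite ltnn.
(* A common edge determines the index: through [dstar_owner] for two double stars, as its end
   outside [S] for two stars. Mixed cases are impossible, since double stars stay inside [S]. *)
case=> [i|w] [j|w'] e /= /imsetP[x /setD1P[xr xS] ->] /imsetP[y /setD1P[yr yS]].
- move=> E; congr inl; apply: val_inj; rewrite /=.
  rewrite -(dstar_owner_parent i (num x)) -[RHS](dstar_owner_parent j (num y)).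
  have -> : dstar_parent i (num x) = num (p i x) by rewrite /p vtxK // plt.
  have -> : dstar_parent j (num y) = num (p j y) by rewrite /p vtxK // plt.
  by have [[-> ->]|[-> ->]] := eq_set2 E; rewrite // dstar_ownerC.
- move=> E; have : val w' \in [set x; p i x] by rewrite E set22.
  by case/set2P=> w'E; have := valP w'; rewrite w'E ?xS // vtxS // plt.
- move=> E; have : val w \in [set y; p j y] by rewrite -E set22.
  by case/set2P=> wE; have := valP w; rewrite wE ?yS // vtxS // plt.
move=> E; congr inr; apply: val_inj.
have [[//]|[xw wy]] := eq_set2 E.
by move: yS; rewrite -wy in_setU1 (negPf (valP w)) orbF => /eqP.
Qed.

(** * The star attains the lower bound *)

Section Star.
Variables (V : finType) (c : V).

Lemma star_card_edge (e : {set V}) : e \in [set [set x; c] | x in [set~ c]] -> #|e| = 2.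
Proof. by case/imsetP=> x; rewrite !inE => xc ->; rewrite cards2 xc. Qed.

Definition star_graph := SGraph star_card_edge.

Lemma star_connected : connected star_graph.
Proof.
have : is_tree (parent_tree [set: V] c (fun=> c)).
  apply: (@parent_tree_is_tree _ _ _ _ (fun x => nat_of_bool (x != c))) => // x _ xc.
  by rewrite eqxx xc.
by rewrite /parent_tree setTD => /andP[].
Qed.

(** Having two vertices, [S] contains a leaf [v], whose only edge goes to [c]. *)
Lemma star_lambda_le1 (S : {set star_graph}) : 1 < #|S| -> lambda S <= 1.
Proof.
move=> S1; have /card_gt0P[v /setD1P[vc vS]] : 0 < #|S :\ c|.
  by move: S1; rewrite (cardsD1 c); case: (c \in S) => //; apply: ltnW.
apply: leq_trans (lambda_le_incident S1 vS) _; apply/card_le1_eqP => e e'.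
have edge_v f : f \in [set e in edges star_graph | v \in e] -> f = [set v; c].
  by rewrite inE => /andP[/imsetP[x _ ->]] /set2P[->|vE] //; rewrite vE eqxx in vc.
by move=> /edge_v -> /edge_v ->.
Qed.

End Star.

Theorem proposition2 (n k : nat) (hk : 3 <= k) (hkn : k <= n) :
  (forall G : sgraph, connected G -> graph_order G = n ->
     1 <= lambda_k k G <= n - uphalf k) /\
  (exists G : sgraph,
     [/\ connected G, graph_order G = n & lambda_k k G = n - uphalf k]) /\
  (exists G : sgraph,
     [/\ connected G, graph_order G = n & lambda_k k G = 1]).
Proof.
have k1 : 1 < k by apply: ltnW.
have bounds (G : sgraph) : connected G -> graph_order G = n ->
    1 <= lambda_k k G <= n - uphalf k.
  (* As [k <= n], the minimum is attained at a genuine [S], so bounds on [lambda S] suffice. *)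
  move=> cG Gn; have [|[S Sk ->] _] := @lambda_kP k G; first by rewrite Gn.
  by rewrite -{1}Gn lambda_ge1 ?Sk // lambda_le.
have n0 : 0 < n by lia.
split=> //; split.
  have cK : connected (complete_graph 'I_n) by apply: complete_connected; rewrite card_ord.
  have Kn : graph_order (complete_graph 'I_n) = n by apply: card_ord.
  exists (complete_graph 'I_n); split=> //; apply/eqP; rewrite eqn_leq.
  have /andP[_ ->] := bounds _ cK Kn.
  have [|[S Sk ->] _] := @lambda_kP k (complete_graph 'I_n); first by rewrite Kn.
  by have := complete_lambda_ge k1 Sk; rewrite card_ord.
pose G := star_graph (Ordinal n0).
have Gn : graph_order G = n by apply: card_ord.
exists G; split=> //; first exact: star_connected.
have /andP[ge1 _] := bounds G (star_connected _) Gn.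
apply/eqP; rewrite eqn_leq ge1 andbT.
have [|[S Sk ->] _] := @lambda_kP k G; first by rewrite Gn.
by apply: star_lambda_le1; rewrite Sk.
Qed.
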